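(* Let $E/\mathbb{Q}$ be an elliptic curve of Mordell--Weil rank $r$ with height torus $\mathcal{T}_E=V_E/M_E$. Within the family of character windows $W_{\ell_1,\ell_2}:\mathcal{T}_E\to(S^1)^2\subset\mathbb{R}^4$ ($\ell_1,\ell_2\in\operatorname{Hom}(M_E,\mathbb{Z})$), the minimum number $m_{\min}$ of four-dimensional windows whose combined homology map (the map $M_E\cong H_1(\mathcal{T}_E,\mathbb{Z})\to\mathbb{Z}^{2m}$ induced on first homology by $m$ windows jointly) is injective is $$m_{\min}=\left\lceil\frac r2\right\rceil.$$
   Context: For an elliptic curve $E/\mathbb{Q}$, $M_E:=E(\mathbb{Q})/E(\mathbb{Q})_{\mathrm{tors}}$ is free abelian of finite rank $r$; $V_E:=M_E\otimes_{\mathbb{Z}}\mathbb{R}$, equipped with the positive-definite canonical height pairing; $\mathcal{T}_E:=V_E/M_E$. For $\ell_1,\ell_2\in\operatorname{Hom}(M_E,\mathbb{Z})$, extended $\mathbb{R}$-linearly to $V_E$, the character window is $$W_{\ell_1,\ell_2}(x)=(\cos2\pi\ell_1(x),\sin2\pi\ell_1(x),\cos2\pi\ell_2(x),\sin2\pi\ell_2(x)).$$ $H_1(\mathcal{T}_E,\mathbb{Z})$ is identified with $M_E$ by sending $P$ to the class of the loop $t\mapsto tP+M_E$, $t\in[0,1]$, and $H_1((S^1)^2,\mathbb{Z})$ with $\mathbb{Z}^2$ by winding numbers. The zero character is allowed. *)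

(* Defs.v *)
From HB Require Import structures.
From mathcomp Require Import all_boot all_order all_algebra.
From mathcomp Require Import generic_quotient ring_quotient.
From mathcomp Require Import ring.
From mathcomp Require Import all_classical all_reals all_analysis.
From mathcomp.multinomials Require Import freeg.

Set Implicit Arguments.
Unset Strict Implicit.
Unset Printing Implicit Defensive.

Import Order.TTheory GRing.Theory Num.Theory.
Import numFieldNormedType.Exports.

Local Open Scope ring_scope.
Local Open Scope quotient_scope.
Local Open Scope classical_set_scope.

Definition weierstrass_disc (a1 a2 a3 a4 a6 : rat) : rat :=
  let b2 := a1 ^+ 2 + 4%:R * a2 in
  let b4 := 2%:R * a4 + a1 * a3 in
  let b6 := a3 ^+ 2 + 4%:R * a6 in
  let b8 := a1 ^+ 2 * a6 + 4%:R * a2 * a6 - a1 * a3 * a4 + a2 * a3 ^+ 2 - a4 ^+ 2 in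
  - b2 ^+ 2 * b8 - 8%:R * b4 ^+ 3 - 27%:R * b6 ^+ 2 + 9%:R * b2 * b4 * b6.

(* y^2 + a1 x y + a3 y = x^3 + a2 x^2 + a4 x + a6 *)
Record elliptic_curve := EllipticCurve {
  ec_a1 : rat;
  ec_a2 : rat;
  ec_a3 : rat;
  ec_a4 : rat;
  ec_a6 : rat;
  ec_smooth : weierstrass_disc ec_a1 ec_a2 ec_a3 ec_a4 ec_a6 != 0
}.

(* None is the point at infinity *)
Definition on_curve (E : elliptic_curve) (p : option (rat * rat)) : bool :=
  if p is Some (x, y) then
    y ^+ 2 + ec_a1 E * x * y + ec_a3 E * y
      == x ^+ 3 + ec_a2 E * x ^+ 2 + ec_a4 E * x + ec_a6 E
  else true.

Definition ec_opp (E : elliptic_curve) (p : option (rat * rat)) : option (rat * rat) :=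
  if p is Some (x, y) then Some (x, - y - ec_a1 E * x - ec_a3 E) else None.

(* chord-tangent law: l is the slope of the line through the two points *)
Definition ec_add (E : elliptic_curve) (p q : option (rat * rat)) : option (rat * rat) :=
  match p, q with
  | None, _ => q
  | _, None => p
  | Some (x1, y1), Some (x2, y2) =>
    if (x1 == x2) && (y2 == - y1 - ec_a1 E * x1 - ec_a3 E) then None
    else
      let l :=
        if x1 == x2 then
          (3%:R * x1 ^+ 2 + 2%:R * ec_a2 E * x1 + ec_a4 E - ec_a1 E * y1)
            / (2%:R * y1 + ec_a1 E * x1 + ec_a3 E)
        else (y2 - y1) / (x2 - x1) in
      let x3 := l ^+ 2 + ec_a1 E * l - ec_a2 E - x1 - x2 in
      Some (x3, - (l * (x3 - x1) + y1) - ec_a1 E * x3 - ec_a3 E)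
  end.

Record ec_point (E : elliptic_curve) := ECPoint {
  ec_val : option (rat * rat);
  ec_valP : on_curve E ec_val
}.

HB.instance Definition _ E := [isSub for @ec_val E].
HB.instance Definition _ E := [Choice of ec_point E by <:].

(* Associativity: completing the square reduces to a1 = a3 = 0; there, three
   families of rational identities (sh_addA_gen, sh_addA_dbl, sh_addA_quad)
   suffice, the degenerate configurations following formally from (P+Q)-Q = P. *)

Section Loop.
Variables (T : eqType) (O : T) (op : T -> T -> T) (inv : T -> T).
Local Notation "x + y" := (op x y).
Local Notation "- x" := (inv x).
Hypothesis opC : commutative op.
Hypothesis op0 : forall x, O + x = x.
Hypothesis opN : forall x, x + - x = O.
Hypothesis invK : involutive inv.
Hypothesis invD : forall x y, - (x + y) = - x + - y.
Hypothesis opK : forall x y, (x + y) + - y = x.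
Hypothesis opA_gen : forall p q r, p != O -> q != O -> r != O ->
  p != q -> p != - q -> q != r -> q != - r -> p != r -> p != - r ->
  p + q != O -> q + r != O ->
  p + q != r -> p + q != - r -> p != q + r -> p != - (q + r) ->
  (p + q) + r = p + (q + r).
Hypothesis opA_dbl : forall p r, p != O -> r != O -> p != - p ->
  p != r -> p != - r -> p + p != O -> p + r != O ->
  p + p != r -> p + p != - r -> p != p + r -> p != - (p + r) ->
  (p + p) + r = p + (p + r).
Hypothesis opA_quad : forall p, p != O -> p != - p -> p + p != O ->
  p != p + p -> p != - (p + p) -> p + p != - (p + p) ->
  p + (p + p) != O -> p != p + (p + p) -> p != - (p + (p + p)) ->
  (p + p) + (p + p) = p + (p + (p + p)).

Let op0r x : x + O = x. Proof. by rewrite opC op0. Qed.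
Let opNl x : - x + x = O. Proof. by rewrite opC opN. Qed.
Let opI r : injective (op^~ r).
Proof. by move=> p q /= e; rewrite -(opK p r) e opK. Qed.
Let opKN x y : (x + - y) + y = x.
Proof. by rewrite -{2}[y]invK opK. Qed.
Let opKl x y : y + (- y + x) = x.
Proof. by rewrite opC [- y + x]opC opKN. Qed.
Let eq_invP p q : p + q = O -> p = - q.
Proof. by move=> e; rewrite -(opK p q) e op0. Qed.

Lemma loop_dbl p r : (p + p) + r = p + (p + r).
Proof.
have [->|p0] := eqVneq p O; first by rewrite !op0.
have [->|r0] := eqVneq r O; first by rewrite !op0r.
have [e|pN] := eqVneq p (- p).
  by rewrite {2}e opN op0 {1}e opC [p + r]opC opK.
have [->|pr] := eqVneq p r; first by rewrite opC.
have [e|prN] := eqVneq p (- r).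
  have -> : r = - p by rewrite e invK.
  by rewrite opN op0r opK.
have [/eq_invP e|ppO] := eqVneq (p + p) O; first by case/eqP: pN.
have [/eq_invP e|prO] := eqVneq (p + r) O; first by case/eqP: prN.
have [e|ppN] := eqVneq (p + p) (- r).
  by rewrite e opNl -[r]invK -e invD opKl opN.
have [e|p1] := eqVneq p (p + r).
  by case/eqP: r0; apply: (@opI p); rewrite op0 opC.
have [e|p2] := eqVneq p (- (p + r)).
  have -> : p + r = - p by rewrite {2}e invK.
  rewrite opN; suff -> : p + p = - r by rewrite opNl.
  by rewrite {2}e invD opKl.
have [e|p3] := eqVneq (p + p) r; last exact: opA_dbl.
by subst r; apply: opA_quad.
Qed.

Lemma loopA : associative op.
Proof.
move=> p q r; symmetry.
have [->|p0] := eqVneq p O; first by rewrite !op0.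
have [->|q0] := eqVneq q O; first by rewrite !op0 op0r.
have [->|r0] := eqVneq r O; first by rewrite !op0r.
have [->|pq] := eqVneq p q; first exact: loop_dbl.
have [->|qr] := eqVneq q r; first by rewrite opC [p + r]opC -loop_dbl opC.
have [->|pr] := eqVneq p r; first by rewrite opC [q + r]opC.
have [->|pqN] := eqVneq p (- q).
  by rewrite opNl op0 [q + r]opC opC opK.
have [->|qrN] := eqVneq q (- r); first by rewrite opKN opNl op0r.
have [->|prN] := eqVneq p (- r).
  by rewrite [- r + q]opC opKN opC opK.
have [/eq_invP e|pqO] := eqVneq (p + q) O; first by case/eqP: pqN.
have [/eq_invP e|qrO] := eqVneq (q + r) O; first by case/eqP: qrN.
have key x y : (x + y) + (x + y) = x + (y + (x + y)).
  apply: (@opI (- x)); rewrite /= loop_dbl [x + (y + _)]opC opK.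
  by rewrite {2}[x + y]opC opK opC.
have [<-|pqr] := eqVneq (p + q) r; first exact: key.
have [e|pqrN] := eqVneq (p + q) (- r).
  by rewrite e opNl -[r]invK -e invD [- p + _]opC opKl opN.
have [e|pqr'] := eqVneq p (q + r).
  by rewrite -e e [q + r]opC key opC [r + q + q]opC.
have [e|pqrN'] := eqVneq p (- (q + r)).
  by rewrite e opNl invD [- q + - r]opC opKN opNl.
exact: opA_gen.
Qed.
End Loop.

Section ShortCurve.
Variables (F : fieldType) (a b c : F).
Hypothesis two_neq0 : (2%:R : F) != 0.
Hypothesis smooth : forall x : F,
  x ^+ 3 + a * x ^+ 2 + b * x + c = 0 -> 3%:R * x ^+ 2 + 2%:R * a * x + b != 0.

Definition sh_on (p : option (F * F)) : bool :=
  if p is Some (x, y) then y ^+ 2 == x ^+ 3 + a * x ^+ 2 + b * x + c else true.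
Definition sh_opp (p : option (F * F)) : option (F * F) :=
  if p is Some (x, y) then Some (x, - y) else None.
Definition sh_line (l x1 x2 y1 : F) : option (F * F) :=
  let x3 := l ^+ 2 - a - x1 - x2 in Some (x3, - (l * (x3 - x1) + y1)).
Definition sh_add (p q : option (F * F)) : option (F * F) :=
  match p, q with
  | None, _ => q
  | _, None => p
  | Some (x1, y1), Some (x2, y2) =>
    if (x1 == x2) && (y1 == - y2) then None
    else sh_line (if x1 == x2 then (3%:R * x1 ^+ 2 + 2%:R * a * x1 + b) / (2%:R * y1)
                  else (y2 - y1) / (x2 - x1)) x1 x2 y1
  end.

Let eqN (y : F) : y = - y -> y = 0.
Proof.
move=> e; apply/eqP; have : 2%:R * y == 0 by rewrite mulr_natl mulr2n {1}e addNr.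
by rewrite mulf_eq0 (negPf two_neq0).
Qed.

Let on_same x y1 y2 : sh_on (Some (x, y1)) -> sh_on (Some (x, y2)) ->
  y1 = y2 \/ y1 = - y2.
Proof.
move=> /eqP e1 /eqP e2; have : y1 ^+ 2 == y2 ^+ 2 by rewrite e1 e2.
rewrite eqf_sqr; by case/orP=> /eqP; [left | right].
Qed.

Lemma sh_chord x1 y1 x2 y2 l : x1 != x2 -> l * (x2 - x1) = y2 - y1 ->
  sh_add (Some (x1, y1)) (Some (x2, y2)) = sh_line l x1 x2 y1.
Proof.
move=> n12 e; rewrite /sh_add (negPf n12) /= -e mulfK //.
by rewrite subr_eq0 eq_sym.
Qed.

Lemma sh_tangent x y l : y != 0 -> l * (2%:R * y) = 3%:R * x ^+ 2 + 2%:R * a * x + b ->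
  sh_add (Some (x, y)) (Some (x, y)) = sh_line l x x y.
Proof.
move=> y0 e; rewrite /sh_add eqxx -e mulfK ?mulf_neq0 //=.
by case: eqP => // /eqN /eqP; rewrite (negPf y0).
Qed.

Lemma sh_addC p q : sh_on p -> sh_on q -> sh_add p q = sh_add q p.
Proof.
case: p q => [[x1 y1]|] [[x2 y2]|] // on1 on2.
have [e|n12] := eqVneq x1 x2.
  subst x2; have [->//|->] := on_same on1 on2.
  by rewrite /sh_add eqxx opprK !eqxx.
have d1 : x2 - x1 != 0 by rewrite subr_eq0 eq_sym.
have d2 : x1 - x2 != 0 by rewrite subr_eq0.
rewrite (@sh_chord _ _ _ _ ((y2 - y1) / (x2 - x1))) ?divfK //.
rewrite (@sh_chord _ _ _ _ ((y2 - y1) / (x2 - x1))) 1?eq_sym //; last by field.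
by rewrite /sh_line; congr (Some (_, _)); field.
Qed.

Lemma sh_oppK : involutive sh_opp.
Proof. by case=> [[x y]|] //=; rewrite opprK. Qed.

Lemma sh_on_opp p : sh_on p -> sh_on (sh_opp p).
Proof. by case: p => [[x y]|] //=; rewrite sqrrN. Qed.

Lemma sh_addN p : sh_add p (sh_opp p) = None.
Proof. by case: p => [[x y]|] //=; rewrite opprK !eqxx. Qed.

Lemma sh_oppD p q : sh_opp (sh_add p q) = sh_add (sh_opp p) (sh_opp q).
Proof.
case: p q => [[x1 y1]|] [[x2 y2]|] //=.
rewrite eqr_opp; case: ifP => // _; rewrite /sh_line /=.
case: ifP => _.
  by rewrite mulrN invrN mulrN sqrrN; congr (Some (_, _)); ring.
by rewrite -opprD mulNr sqrrN; congr (Some (_, _)); ring.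
Qed.

Variant add_spec x1 y1 x2 y2 : option (F * F) -> Type :=
| AddOpp of x1 = x2 & y1 = - y2 : add_spec x1 y1 x2 y2 None
| AddTan l of x1 = x2 & y1 = y2 & y1 != 0 &
    l * (2%:R * y1) = 3%:R * x1 ^+ 2 + 2%:R * a * x1 + b :
    add_spec x1 y1 x2 y2 (sh_line l x1 x1 y1)
| AddChord l of x1 != x2 & l * (x2 - x1) = y2 - y1 :
    add_spec x1 y1 x2 y2 (sh_line l x1 x2 y1).

Lemma sh_addP x1 y1 x2 y2 : sh_on (Some (x1, y1)) -> sh_on (Some (x2, y2)) ->
  add_spec x1 y1 x2 y2 (sh_add (Some (x1, y1)) (Some (x2, y2))).
Proof.
move=> on1 on2; have [e|n12] := eqVneq x1 x2; last first.
  have d : x2 - x1 != 0 by rewrite subr_eq0 eq_sym.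
  rewrite (@sh_chord _ _ _ _ ((y2 - y1) / (x2 - x1))) ?divfK //.
  by constructor => //; rewrite divfK.
subst x2; have [e|nN] := eqVneq y1 (- y2).
  by rewrite /sh_add eqxx e eqxx; constructor.
have e : y1 = y2 by case: (on_same on1 on2) => // /eqP; rewrite (negPf nN).
subst y2; have y0 : y1 != 0 by apply: contraNneq nN => ->; rewrite oppr0.
have h : 2%:R * y1 != 0 by rewrite mulf_neq0.
rewrite (@sh_tangent _ _ ((3%:R * x1 ^+ 2 + 2%:R * a * x1 + b) / (2%:R * y1))) ?divfK //.
by constructor => //; rewrite divfK.
Qed.

Let cancel0 (d e : F) : d != 0 -> d * e = 0 -> e = 0.
Proof. by move=> d0 /eqP; rewrite mulf_eq0 (negPf d0) => /eqP. Qed.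

Lemma sh_on_add p q : sh_on p -> sh_on q -> sh_on (sh_add p q).
Proof.
case: p q => [[x1 y1]|] [[x2 y2]|] // on1 on2.
case: (sh_addP on1 on2) => //.
  move=> l ? ? y0 el; subst x2 y2.
  have h : 2%:R * y1 != 0 by rewrite mulf_neq0.
  rewrite /sh_line /=; apply/eqP; move/eqP: on1 => e1.
  have eb : b = l * (2%:R * y1) - 3%:R * x1 ^+ 2 - 2%:R * a * x1 by rewrite el; ring.
  have ec : c = y1 ^+ 2 - (x1 ^+ 3 + a * x1 ^+ 2 + b * x1) by rewrite e1; ring.
  by rewrite ec eb; ring.
move=> l n12 el; rewrite /sh_line /=; apply/eqP.
move/eqP: on1 => e1; move/eqP: on2 => e2.
have d : x2 - x1 != 0 by rewrite subr_eq0 eq_sym.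
have ey : y2 = y1 + l * (x2 - x1) by rewrite el; ring.
have ec : c = y1 ^+ 2 - (x1 ^+ 3 + a * x1 ^+ 2 + b * x1) by rewrite e1; ring.
have eb : b = 2%:R * y1 * l + l ^+ 2 * (x2 - x1) - (x1 ^+ 2 + x1 * x2 + x2 ^+ 2)
               - a * (x1 + x2).
  apply/eqP; rewrite -subr_eq0; apply/eqP; apply: (cancel0 d).
  move: e2; rewrite ec ey => /eqP; rewrite -subr_eq0 => /eqP e2.
  by rewrite -[RHS]oppr0 -{}e2; ring.
by rewrite ec eb; ring.
Qed.

Lemma sh_addK p q : sh_on p -> sh_on q -> sh_add (sh_add p q) (sh_opp q) = p.
Proof.
case: p q => [[x1 y1]|] [[x2 y2]|] // on1 on2; last exact: sh_addN.
have on3 := sh_on_add on1 on2; move: on3.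
case: (sh_addP on1 on2) => [-> -> //|l ? ? y0 el|l n12 el]; rewrite /sh_line /=.
  subst x2 y2; set x3 := l ^+ 2 - a - x1 - x1; set y3 := - (l * (x3 - x1) + y1) => on3.
  move: (sh_addP on3 (sh_on_opp on1)) => /=.
  have [e3|n3] := eqVneq x3 x1.
    have ey : y3 = - y1 by rewrite /y3 e3; ring.
    rewrite ey e3; case=> [_ /eqP|l' _ _ _ el'|l']; rewrite ?eqxx //.
      by rewrite opprK; case: eqP => // /esym /eqN /eqP; rewrite (negPf y0).
    have -> : l' = - l.
      apply: (@mulIf _ (2%:R * - y1)); first by rewrite mulf_neq0 ?oppr_eq0.
      by rewrite el' -el; ring.
    by rewrite /sh_line sqrrN -/x3 e3; congr (Some (_, _)); ring.
  case=> [/eqP|l' /eqP|l' _ el']; rewrite ?(negPf n3) //.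
  have -> : l' = - l.
    apply: (@mulIf _ (x1 - x3)); first by rewrite subr_eq0 eq_sym.
    by rewrite el' /y3; ring.
  rewrite /sh_line; congr (Some (_, _)); rewrite /y3 /x3; ring.
set x3 := l ^+ 2 - a - x1 - x2; set y3 := - (l * (x3 - x1) + y1) => on3.
have d : x2 - x1 != 0 by rewrite subr_eq0 eq_sym.
have ey1 : y1 = y2 - l * (x2 - x1) by rewrite el; ring.
move: (on1) (on2) => /eqP e1 /eqP e2.
have ec : c = y2 ^+ 2 - (x2 ^+ 3 + a * x2 ^+ 2 + b * x2) by rewrite e2; ring.
have eb : b = 2%:R * y2 * l - l ^+ 2 * (x2 - x1) - (x1 ^+ 2 + x1 * x2 + x2 ^+ 2)
               - a * (x1 + x2).
  apply/eqP; rewrite -subr_eq0; apply/eqP; apply: (cancel0 d).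
  move: e1; rewrite ec ey1 => /eqP; rewrite -subr_eq0 => /eqP e1.
  by rewrite -{}e1; ring.
have ey3 : y3 = - (y2 + l * (x3 - x2)) by rewrite /y3 ey1; ring.
move: (sh_addP on3 (sh_on_opp on2)) => /=.
have [e3|n3] := eqVneq x3 x2.
  have ea : a = l ^+ 2 - x1 - 2%:R * x2.
    have : a = l ^+ 2 - x1 - x2 - x3 by rewrite /x3; ring.
    by rewrite e3 => ->; ring.
  have et : 2%:R * y2 * l = 3%:R * x2 ^+ 2 + 2%:R * a * x2 + b by rewrite eb ea; ring.
  have ey : y3 = - y2 by rewrite ey3 e3; ring.
  have y20 : y2 != 0.
    apply/eqP=> y20; have /smooth : x2 ^+ 3 + a * x2 ^+ 2 + b * x2 + c = 0.
      by rewrite -e2 y20 expr0n.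
    by rewrite -et y20 mulr0 mul0r eqxx.
  rewrite ey e3; case=> [_ /eqP|l' _ _ _ el'|l']; rewrite ?eqxx //.
    by rewrite opprK; case: eqP => // /esym /eqN /eqP; rewrite (negPf y20).
  have -> : l' = - l.
    apply: (@mulIf _ (2%:R * - y2)); first by rewrite mulf_neq0 ?oppr_eq0.
    by rewrite el' -et; ring.
  by rewrite /sh_line; congr (Some (_, _)); rewrite ?ey1 ea; ring.
case=> [/eqP|l' /eqP|l' _ el']; rewrite ?(negPf n3) //.
have -> : l' = - l.
  apply: (@mulIf _ (x2 - x3)); first by rewrite subr_eq0 eq_sym.
  by rewrite el' ey3; ring.
by rewrite /sh_line; congr (Some (_, _)); rewrite ?ey3 ?ey1 /x3; ring.
Qed.


Let neq0_mul (x d e : F) : x = d * e -> d != 0 -> e != 0 -> x != 0.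
Proof. by move=> -> *; rewrite mulf_neq0. Qed.

Let assoc_gen (x1 x2 x3 y2 l m : F) : x1 - x3 != 0 ->
  let y1 := y2 + l * (x1 - x2) in
  let y3 := y2 + m * (x3 - x2) in
  let A := (2%:R * y2 * (l - m) + l ^+ 2 * (x1 - x2) - m ^+ 2 * (x3 - x2)) / (x1 - x3)
     - (x1 + x2 + x3) in
  let x4 := l ^+ 2 - A - x1 - x2 in
  let y4 := - (l * (x4 - x1) + y1) in
  let x5 := m ^+ 2 - A - x2 - x3 in
  let y5 := - (m * (x5 - x2) + y2) in
  x3 - x4 != 0 -> x5 - x1 != 0 ->
  let n := (y3 - y4) / (x3 - x4) in
  let k := (y5 - y1) / (x5 - x1) in
  let x6 := n ^+ 2 - A - x4 - x3 in
  let x7 := k ^+ 2 - A - x1 - x5 in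
  x6 = x7 /\ n * (x6 - x4) + y4 = k * (x7 - x1) + y1.
Proof.
move=> h1 /= h2 h3.
split; field; do ?[apply/andP; split]; rewrite //;
  solve [apply: (neq0_mul _ h1 h2); by field | apply: (neq0_mul _ h1 h3); by field].
Qed.

Let dbl_gen (x1 x2 y1 l m : F) : x2 - x1 != 0 ->
  let y2 := y1 + m * (x2 - x1) in
  let A := 2%:R * y1 * (m - l) / (x2 - x1) + m ^+ 2 - x2 - 2%:R * x1 in
  let x4 := l ^+ 2 - A - x1 - x1 in
  let y4 := - (l * (x4 - x1) + y1) in
  let x5 := m ^+ 2 - A - x1 - x2 in
  let y5 := - (m * (x5 - x1) + y1) in
  x2 - x4 != 0 -> x5 - x1 != 0 ->
  let n := (y2 - y4) / (x2 - x4) in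
  let k := (y5 - y1) / (x5 - x1) in
  let x6 := n ^+ 2 - A - x4 - x2 in
  let x7 := k ^+ 2 - A - x1 - x5 in
  x6 = x7 /\ n * (x6 - x4) + y4 = k * (x7 - x1) + y1.
Proof.
move=> h1 /= h2 h3.
split; field; do ?[apply/andP; split]; rewrite //;
  solve [apply: (neq0_mul _ h1 h2); by field | apply: (neq0_mul _ h1 h3); by field].
Qed.

Let quad_gen (A x1 y1 l : F) :
  let B := l * (2%:R * y1) - 3%:R * x1 ^+ 2 - 2%:R * A * x1 in
  let x2 := l ^+ 2 - A - x1 - x1 in
  let y2 := - (l * (x2 - x1) + y1) in
  x2 - x1 != 0 -> y2 != 0 ->
  let m := (y2 - y1) / (x2 - x1) in
  let x3 := m ^+ 2 - A - x1 - x2 in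
  let y3 := - (m * (x3 - x1) + y1) in
  x3 - x1 != 0 ->
  let n := (y3 - y1) / (x3 - x1) in
  let k := (3%:R * x2 ^+ 2 + 2%:R * A * x2 + B) / (2%:R * y2) in
  let x6 := k ^+ 2 - A - x2 - x2 in
  let x7 := n ^+ 2 - A - x1 - x3 in
  x6 = x7 /\ k * (x6 - x2) + y2 = n * (x7 - x1) + y1.
Proof.
move=> /= h1 h2 h3.
split; field; do ?[apply/andP; split]; rewrite //;
  by apply: (neq0_mul _ h1 (mulf_neq0 h1 h3)); field.
Qed.


Let chord_b x1 y1 x2 l : x1 != x2 -> sh_on (Some (x1, y1)) ->
  sh_on (Some (x2, y1 + l * (x2 - x1))) ->
  b = 2%:R * y1 * l + l ^+ 2 * (x2 - x1) - (x1 ^+ 2 + x1 * x2 + x2 ^+ 2) - a * (x1 + x2).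
Proof.
move=> n12 /eqP e1 /eqP e2.
have d : x2 - x1 != 0 by rewrite subr_eq0 eq_sym.
have ec : c = y1 ^+ 2 - (x1 ^+ 3 + a * x1 ^+ 2 + b * x1) by rewrite e1; ring.
apply/eqP; rewrite -subr_eq0; apply/eqP; apply: (cancel0 d).
move: e2; rewrite ec => /eqP; rewrite -subr_eq0 => /eqP e2.
by rewrite -[RHS]oppr0 -{}e2; ring.
Qed.

Let slopeE (x1 y1 x2 y2 : F) : x1 != x2 -> y2 = y1 + (y2 - y1) / (x2 - x1) * (x2 - x1).
Proof.
by move=> n12; rewrite divfK ?subr_eq0 1?eq_sym // addrC subrK.
Qed.

Let npt x1 y1 x2 y2 : sh_on (Some (x1, y1)) -> sh_on (Some (x2, y2)) ->
  Some (x1, y1) != Some (x2, y2) -> Some (x1, y1) != sh_opp (Some (x2, y2)) ->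
  x1 != x2.
Proof.
move=> on1 on2 n nN; apply/eqP=> e; subst x2.
by case: (on_same on1 on2) => e; [case/eqP: n | case/eqP: nN]; rewrite /= e.
Qed.

Lemma sh_addA_gen p q r : sh_on p -> sh_on q -> sh_on r ->
  p != None -> q != None -> r != None ->
  p != q -> p != sh_opp q -> q != r -> q != sh_opp r -> p != r -> p != sh_opp r ->
  sh_add p q != None -> sh_add q r != None ->
  sh_add p q != r -> sh_add p q != sh_opp r ->
  p != sh_add q r -> p != sh_opp (sh_add q r) ->
  sh_add (sh_add p q) r = sh_add p (sh_add q r).
Proof.
case: p q r => [[x1 y1]|] [[x2 y2]|] [[x3 y3]|] // on1 on2 on3 _ _ _.
move=> /(npt on1 on2) h /h n12 {h} /(npt on2 on3) h /h n23 {h} /(npt on1 on3) h /h n13 {h} _ _.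
move: (sh_on_add on1 on2) (sh_on_add on2 on3).
set l := (y1 - y2) / (x1 - x2); set m := (y3 - y2) / (x3 - x2).
have n21 : x2 != x1 by rewrite eq_sym.
have n32 : x3 != x2 by rewrite eq_sym.
have ey1 : y1 = y2 + l * (x1 - x2) by exact: slopeE.
have ey3 : y3 = y2 + m * (x3 - x2) by exact: slopeE.
have bl : b = _ := chord_b n21 on2 (etrans (congr1 (fun y => sh_on (Some (x1, y))) (esym ey1)) on1).
have bm : b = _ := chord_b n23 on2 (etrans (congr1 (fun y => sh_on (Some (x3, y))) (esym ey3)) on3).
have d13 : x1 - x3 != 0 by rewrite subr_eq0.
have ea : a = (2%:R * y2 * (l - m) + l ^+ 2 * (x1 - x2) - m ^+ 2 * (x3 - x2)) / (x1 - x3)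
     - (x1 + x2 + x3).
  apply/eqP; rewrite -subr_eq0; apply/eqP; apply: (cancel0 d13).
  move: bm; rewrite {1}bl => /eqP; rewrite -subr_eq0 => /eqP bm.
  by rewrite -[RHS]oppr0 -{}bm; field.
clear bl bm; move: on1; clear on2.
rewrite (@sh_chord x1 y1 x2 y2 l) //; last by rewrite ey1; ring.
rewrite (@sh_chord x2 y2 x3 y3 m) //; last by rewrite ey3; ring.
rewrite /sh_line; set x4 := l ^+ 2 - a - x1 - x2; set y4 := - (l * (x4 - x1) + y1); set x5 := m ^+ 2 - a - x2 - x3; set y5 := - (m * (x5 - x2) + y2).
move=> on1 on4 on5 /(npt on4 on3) h /h n43 {h} /(npt on1 on5) h /h n15 {h on1 on3 on4 on5}.
have n34 : x3 != x4 by rewrite eq_sym.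
have d43 : x3 - x4 != 0 by rewrite subr_eq0.
have d51 : x5 - x1 != 0 by rewrite subr_eq0 eq_sym.
rewrite (@sh_chord x4 y4 x3 y3 ((y3 - y4) / (x3 - x4))) ?divfK //.
rewrite (@sh_chord x1 y1 x5 y5 ((y5 - y1) / (x5 - x1))) ?divfK //.
have := @assoc_gen x1 x2 x3 y2 l m d13.
rewrite /= -ea -ey1 -ey3 -/x4 -/x5 -/y4 -/y5 => /(_ d43 d51) [E1 E2].
by rewrite /sh_line E2 E1.
Qed.

Lemma sh_addA_dbl p r : sh_on p -> sh_on r -> p != None -> r != None -> p != sh_opp p ->
  p != r -> p != sh_opp r -> sh_add p p != None -> sh_add p r != None ->
  sh_add p p != r -> sh_add p p != sh_opp r ->
  p != sh_add p r -> p != sh_opp (sh_add p r) ->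
  sh_add (sh_add p p) r = sh_add p (sh_add p r).
Proof.
case: p r => [[x1 y1]|] [[x2 y2]|] // on1 on2 _ _ nN.
move=> /(npt on1 on2) h /h n12 {h} _ _.
have y10 : y1 != 0 by apply: contraNneq nN => -> /=; rewrite oppr0.
move: (sh_on_add on1 on1) (sh_on_add on1 on2).
set l := (3%:R * x1 ^+ 2 + 2%:R * a * x1 + b) / (2%:R * y1).
have el : l * (2%:R * y1) = 3%:R * x1 ^+ 2 + 2%:R * a * x1 + b.
  by rewrite divfK // mulf_neq0.
set m := (y2 - y1) / (x2 - x1).
have ey2 : y2 = y1 + m * (x2 - x1) by exact: slopeE.
have bm : b = _ := chord_b n12 on1 (etrans (congr1 (fun y => sh_on (Some (x2, y))) (esym ey2)) on2).
have d21 : x2 - x1 != 0 by rewrite subr_eq0 eq_sym.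
have bl : b = l * (2%:R * y1) - 3%:R * x1 ^+ 2 - 2%:R * a * x1 by rewrite el; ring.
have ea : a = 2%:R * y1 * (m - l) / (x2 - x1) + m ^+ 2 - x2 - 2%:R * x1.
  apply/eqP; rewrite -subr_eq0; apply/eqP; apply: (cancel0 d21).
  move: bm; rewrite {1}bl => /eqP; rewrite -subr_eq0 => /eqP bm.
  by rewrite -{}bm; field.
clear bl bm.
rewrite (sh_tangent y10 el) (@sh_chord x1 y1 x2 y2 m) //; last by rewrite ey2; ring.
rewrite /sh_line; set x4 := l ^+ 2 - a - x1 - x1; set y4 := - (l * (x4 - x1) + y1).
set x5 := m ^+ 2 - a - x1 - x2; set y5 := - (m * (x5 - x1) + y1).
move=> on4 on5 /(npt on4 on2) h /h n42 {h} /(npt on1 on5) h /h n15 {h}.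
have d42 : x2 - x4 != 0 by rewrite subr_eq0 eq_sym.
have d51 : x5 - x1 != 0 by rewrite subr_eq0 eq_sym.
rewrite (@sh_chord x4 y4 x2 y2 ((y2 - y4) / (x2 - x4))) ?divfK //.
rewrite (@sh_chord x1 y1 x5 y5 ((y5 - y1) / (x5 - x1))) ?divfK //.
have := @dbl_gen x1 x2 y1 l m d21.
rewrite /= -ea -ey2 -/x4 -/x5 -/y4 -/y5 => /(_ d42 d51) [E1 E2].
by rewrite /sh_line E2 E1.
Qed.

Lemma sh_addA_quad p : sh_on p -> p != None -> p != sh_opp p -> sh_add p p != None ->
  p != sh_add p p -> p != sh_opp (sh_add p p) -> sh_add p p != sh_opp (sh_add p p) ->
  sh_add p (sh_add p p) != None -> p != sh_add p (sh_add p p) ->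
  p != sh_opp (sh_add p (sh_add p p)) ->
  sh_add (sh_add p p) (sh_add p p) = sh_add p (sh_add p (sh_add p p)).
Proof.
case: p => [[x1 y1]|] // on1 _ nN _.
have y10 : y1 != 0 by apply: contraNneq nN => -> /=; rewrite oppr0.
have on2 := sh_on_add on1 on1; have on3 := sh_on_add on1 on2; move: on2 on3.
set l := (3%:R * x1 ^+ 2 + 2%:R * a * x1 + b) / (2%:R * y1).
have el : l * (2%:R * y1) = 3%:R * x1 ^+ 2 + 2%:R * a * x1 + b.
  by rewrite divfK // mulf_neq0.
have eb : b = l * (2%:R * y1) - 3%:R * x1 ^+ 2 - 2%:R * a * x1 by rewrite el; ring.
set x2 := l ^+ 2 - a - x1 - x1; set y2 := - (l * (x2 - x1) + y1).
have -> : sh_add (Some (x1, y1)) (Some (x1, y1)) = Some (x2, y2) by exact: sh_tangent.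
move=> on2 on3 /(npt on1 on2) h /h n12 {h} n22 _; move: on3.
have y20 : y2 != 0 by apply: contraNneq n22 => -> /=; rewrite oppr0.
have d21 : x2 - x1 != 0 by rewrite subr_eq0 eq_sym.
set m := (y2 - y1) / (x2 - x1); set x3 := m ^+ 2 - a - x1 - x2; set y3 := - (m * (x3 - x1) + y1).
have -> : sh_add (Some (x1, y1)) (Some (x2, y2)) = Some (x3, y3).
  by apply: sh_chord; rewrite // divfK.
move=> on3 /(npt on1 on3) h /h n13 {h}.
have d31 : x3 - x1 != 0 by rewrite subr_eq0 eq_sym.
rewrite (@sh_chord x1 y1 x3 y3 ((y3 - y1) / (x3 - x1))) ?divfK //.
rewrite (@sh_tangent x2 y2 ((3%:R * x2 ^+ 2 + 2%:R * a * x2 + b) / (2%:R * y2))) ?divfK ?mulf_neq0 //.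
have := @quad_gen a x1 y1 l.
rewrite /= -eb -/x2 -/y2 => /(_ d21 y20); rewrite -/m -/x3 -/y3 => /(_ d31) [E1 E2].
by rewrite /sh_line E2 E1.
Qed.
End ShortCurve.

Section GroupLaw.
Variable E : elliptic_curve.
Local Notation a1 := (ec_a1 E).
Local Notation a2 := (ec_a2 E).
Local Notation a3 := (ec_a3 E).
Local Notation a4 := (ec_a4 E).
Local Notation a6 := (ec_a6 E).

Let a : rat := a2 + a1 ^+ 2 / 4%:R.
Let b : rat := a4 + a1 * a3 / 2%:R.
Let c : rat := a6 + a3 ^+ 2 / 4%:R.
Let s (x : rat) : rat := (a1 * x + a3) / 2%:R.

Let two0 : (2%:R : rat) != 0. Proof. by []. Qed.

Let smooth x : x ^+ 3 + a * x ^+ 2 + b * x + c = 0 -> 3%:R * x ^+ 2 + 2%:R * a * x + b != 0.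
Proof.
move=> ec; apply/eqP=> eb; have := ec_smooth E.
have Ea2 : a2 = a - a1 ^+ 2 / 4%:R by rewrite /a; ring.
have Eb : b = - (3%:R * x ^+ 2 + 2%:R * a * x).
  by apply/eqP; rewrite -subr_eq0 opprK addrC; apply/eqP.
have Ec : c = - (x ^+ 3 + a * x ^+ 2 + b * x).
  by apply/eqP; rewrite -subr_eq0 opprK addrC; apply/eqP.
have Ea4 : a4 = b - a1 * a3 / 2%:R by rewrite /b; ring.
have Ea6 : a6 = c - a3 ^+ 2 / 4%:R by rewrite /c; ring.
move: Ea2 Ea4 Ea6; rewrite Ec Eb /weierstrass_disc => -> -> ->.
by case/eqP; field.
Qed.

Let toS (p : option (rat * rat)) := if p is Some (x, y) then Some (x, y + s x) else None.

Let toS_inj : injective toS.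
Proof.
case=> [[x1 y1]|] [[x2 y2]|] //= [-> /eqP]; rewrite -subr_eq0 => e.
congr (Some (_, _)); apply/eqP; rewrite -subr_eq0; apply/eqP.
by rewrite -(eqP e); ring.
Qed.

Let toS_on p : sh_on a b c (toS p) = on_curve E p.
Proof.
case: p => [[x y]|] //=; rewrite -subr_eq0 -[RHS]subr_eq0; congr (_ == 0).
by rewrite /a /b /c /s; field.
Qed.

Let fromS p : exists q, toS q = p.
Proof.
by case: p => [[x y]|]; [exists (Some (x, y - s x)); rewrite /= subrK | exists None].
Qed.

Let toS_opp p : toS (ec_opp E p) = sh_opp (toS p).
Proof. by case: p => [[x y]|] //=; congr (Some (_, _)); rewrite /s; field. Qed.

Let toS_add p q : on_curve E p -> on_curve E q -> toS (ec_add E p q) = sh_add a b (toS p) (toS q).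
Proof.
case: p q => [[x1 y1]|] [[x2 y2]|] //.
rewrite -!toS_on => on1 on2; rewrite /toS /ec_add /sh_add.
have [e|n12] := eqVneq x1 x2; last first.
  rewrite /= /sh_line; have d : x2 - x1 != 0 by rewrite subr_eq0 eq_sym.
  have -> : (y2 + s x2 - (y1 + s x1)) / (x2 - x1) = (y2 - y1) / (x2 - x1) + a1 / 2%:R.
    by rewrite /s; field.
  by move: (_ / _) => l; rewrite /= /a /s; congr (Some (_, _)); field.
subst x2; rewrite /=.
have -> : (y1 + s x1 == - (y2 + s x1)) = (y2 == - y1 - a1 * x1 - a3).
  rewrite -subr_eq0 -[RHS]subr_eq0; congr (_ == 0).
  by rewrite /s; field.
case: ifP => //= ny; rewrite /sh_line.
have d : 2%:R * y1 + a1 * x1 + a3 != 0.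
  apply/eqP=> d; move/eqP: ny; apply; move: on1 on2 => /= /eqP e1 /eqP e2.
  have : (y2 + s x1) ^+ 2 == (y1 + s x1) ^+ 2 by rewrite e1 e2.
  have -> : y1 + s x1 = (2%:R * y1 + a1 * x1 + a3) / 2%:R by rewrite /s; field.
  rewrite d mul0r expr0n sqrf_eq0 => /eqP e; apply/eqP; rewrite -subr_eq0.
  have -> : y2 - (- y1 - a1 * x1 - a3) = (y2 + s x1) + (2%:R * y1 + a1 * x1 + a3) / 2%:R.
    by rewrite /s; field.
  by rewrite d e mul0r addr0.
have d' : 2%:R * (y1 + s x1) = 2%:R * y1 + a1 * x1 + a3 by rewrite /s; field.
have -> : (3%:R * x1 ^+ 2 + 2%:R * a * x1 + b) / (2%:R * (y1 + s x1))
    = (3%:R * x1 ^+ 2 + 2%:R * a2 * x1 + a4 - a1 * y1) / (2%:R * y1 + a1 * x1 + a3) + a1 / 2%:R.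
  by rewrite d' /a /b; field.
by move: (_ / (2%:R * y1 + _ + _)) => l; rewrite /a /s; congr (Some (_, _)); field.
Qed.

Lemma on_curve_opp p : on_curve E p -> on_curve E (ec_opp E p).
Proof. by rewrite -!toS_on toS_opp; apply: sh_on_opp. Qed.

Lemma on_curve_add p q : on_curve E p -> on_curve E q -> on_curve E (ec_add E p q).
Proof.
move=> onp onq; rewrite -toS_on toS_add //.
by apply: sh_on_add; rewrite // toS_on.
Qed.

Definition pt0 : ec_point E := @ECPoint E None isT.
Definition pt_opp (P : ec_point E) : ec_point E :=
  ECPoint (on_curve_opp (ec_valP P)).
Definition pt_add (P Q : ec_point E) : ec_point E :=
  ECPoint (on_curve_add (ec_valP P) (ec_valP Q)).

Let toP (P : ec_point E) := toS (ec_val P).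
Let toP_inj : injective toP.
Proof. by move=> P Q /toS_inj /val_inj. Qed.
Let toP_on P : sh_on a b c (toP P).
Proof. by rewrite toS_on; exact: ec_valP. Qed.
Let toP_add P Q : toP (pt_add P Q) = sh_add a b (toP P) (toP Q).
Proof. by apply: toS_add; exact: ec_valP. Qed.
Let toP_opp P : toP (pt_opp P) = sh_opp (toP P).
Proof. exact: toS_opp. Qed.
Let toP_eq P Q : (toP P == toP Q) = (P == Q).
Proof. exact: inj_eq. Qed.
Let toP0 : None = toP pt0. Proof. by []. Qed.

Lemma pt_addC : commutative pt_add.
Proof. by move=> P Q; apply: toP_inj; rewrite !toP_add (@sh_addC _ a b c) ?toP_on. Qed.

Lemma pt_add0 : left_id pt0 pt_add.
Proof. by move=> P; apply: val_inj. Qed.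

Lemma pt_addN : right_inverse pt0 pt_opp pt_add.
Proof. by move=> P; apply: toP_inj; rewrite toP_add toP_opp sh_addN. Qed.

Lemma pt_addA : associative pt_add.
Proof.
apply: (@loopA _ pt0 pt_add pt_opp).
- exact: pt_addC.
- exact: pt_add0.
- exact: pt_addN.
- by move=> P; apply: toP_inj; rewrite !toP_opp sh_oppK.
- by move=> P Q; apply: toP_inj; rewrite !(toP_opp, toP_add) sh_oppD.
- by move=> P Q; apply: toP_inj; rewrite !(toP_opp, toP_add) (@sh_addK _ a b c) ?toP_on.
- move=> P Q R *; apply: toP_inj; rewrite !toP_add.
  by apply: (sh_addA_gen two0); rewrite -?toP_add -?toP_opp ?toP0 ?toP_eq ?toP_on.
- move=> P R *; apply: toP_inj; rewrite !toP_add.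
  by apply: (sh_addA_dbl two0); rewrite -?toP_add -?toP_opp ?toP0 ?toP_eq ?toP_on.
- move=> P *; apply: toP_inj; rewrite !toP_add.
  by apply: (sh_addA_quad two0); rewrite -?toP_add -?toP_opp ?toP0 ?toP_eq ?toP_on.
Qed.
End GroupLaw.

HB.instance Definition _ (E : elliptic_curve) :=
  GRing.isZmodule.Build (ec_point E) (@pt_addA E) (@pt_addC E) (@pt_add0 E)
    (fun P => etrans (pt_addC _ P) (pt_addN P)).

Definition torsion (A : zmodType) : {pred A} :=
  fun P => `[< exists2 n : nat, (0 < n)%N & P *+ n = 0 >].

Lemma torsion_zmod_closed (A : zmodType) : zmod_closed (@torsion A).
Proof.
split; first by apply/asboolP; exists 1%N; rewrite ?mul0rn.
move=> P Q /asboolP[m m0 Pm] /asboolP[n n0 Qn]; apply/asboolP.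
exists (m * n)%N; first by rewrite muln_gt0 m0.
by rewrite mulrnBl mulrnA Pm mul0rn mulnC mulrnA Qn mul0rn subr0.
Qed.

HB.instance Definition _ (A : zmodType) :=
  GRing.isZmodClosed.Build A (@torsion A) (@torsion_zmod_closed A).

(* M_E = E(Q) / E(Q)_tors *)
Definition mw_lattice (E : elliptic_curve) : zmodType :=
  Quotient.quot (@torsion (ec_point E)).

Definition is_Zbasis (M : zmodType) (r : nat) (e : 'I_r -> M) : Prop :=
  forall P : M, exists! k : 'rV[int]_r, P = \sum_(i < r) e i *~ k 0 i.

(* M_E is free of rank r; every E has such an r by Mordell's theorem *)
Definition mordell_weil_rank (E : elliptic_curve) (r : nat) : Prop :=
  exists e : 'I_r -> mw_lattice E, is_Zbasis e.

(* M (x)_Z R, built as the free R-module on M modulo the R-span of the elements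
   <<P + Q>> - <<P>> - <<Q>>; P (x) c is the class of c *: <<P>>. *)
Section ExtensionOfScalars.
Variables (R : realType) (M : zmodType).

Definition add_relation (P Q : M) : {freeg M / R} := << P + Q >> - << P >> - << Q >>.

Definition add_relations : {pred {freeg M / R}} :=
  fun v => `[< exists s : seq (R * (M * M)),
    v = \sum_(x <- s) x.1 *: add_relation x.2.1 x.2.2 >].

Lemma add_relations_submod : submod_closed add_relations.
Proof.
split; first by apply/asboolP; exists [::]; rewrite big_nil.
move=> k u v /asboolP[s ->] /asboolP[t ->]; apply/asboolP.
exists ([seq (k * x.1, x.2) | x <- s] ++ t).
rewrite big_cat big_map scaler_sumr /=; congr (_ + _).
by apply: eq_bigr => x _; rewrite scalerA.
Qed.

HB.instance Definition _ :=
  GRing.isSubmodClosed.Build R {freeg M / R} add_relations add_relations_submod.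

Definition realification : Type := Quotient.quot add_relations.

HB.instance Definition _ := GRing.Zmodule.on realification.

Definition to_realification (u : {freeg M / R}) : realification :=
  \pi_(Quotient.quot add_relations) u.

Definition realification_scale (k : R) (v : realification) : realification :=
  to_realification (k *: repr (v : Quotient.quot add_relations)).

Lemma to_realificationP (v : realification) :
  to_realification (repr (v : Quotient.quot add_relations)) = v.
Proof. exact: reprK. Qed.

Lemma to_realification_eq u v :
  (to_realification u == to_realification v) = (u - v \in add_relations).
Proof. by rewrite Quotient.idealrBE. Qed.

Lemma to_realificationD u v :
  to_realification (u + v) = to_realification u + to_realification v.
Proof. exact: (raddfD (\pi_(Quotient.quot add_relations))). Qed.

Lemma realification_scaleE k u :
  realification_scale k (to_realification u) = to_realification (k *: u).
Proof.
apply/eqP; rewrite to_realification_eq -scalerBr rpredZ //.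
by rewrite -to_realification_eq to_realificationP.
Qed.

Lemma realification_scaleA k l v :
  realification_scale k (realification_scale l v) = realification_scale (k * l) v.
Proof. by rewrite realification_scaleE scalerA. Qed.

Lemma realification_scale1 : left_id 1 realification_scale.
Proof. by move=> v; rewrite /realification_scale scale1r to_realificationP. Qed.

Lemma realification_scaleDr : right_distributive realification_scale +%R.
Proof.
move=> k u v; rewrite -(to_realificationP u) -(to_realificationP v).
by rewrite -to_realificationD !realification_scaleE scalerDr to_realificationD.
Qed.

Lemma realification_scaleDl v : {morph realification_scale^~ v : k l / k + l}.
Proof. by move=> k l; rewrite /realification_scale scalerDl to_realificationD. Qed.

HB.instance Definition _ := GRing.Zmodule_isLmodule.Build R realification
  realification_scaleA realification_scale1 realification_scaleDr realification_scaleDl.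

(* P |-> P (x) 1 *)
Definition real_point (P : M) : realification := to_realification << P >>.

Lemma real_pointD P Q : real_point (P + Q) = real_point P + real_point Q.
Proof.
rewrite -to_realificationD; apply/eqP; rewrite to_realification_eq.
apply/asboolP; exists [:: (1, (P, Q))].
by rewrite big_seq1 scale1r /add_relation opprD addrA.
Qed.

Lemma real_point_zmod_morphism : zmod_morphism real_point.
Proof.
move=> P Q; apply: (addIr (real_point Q)).
by rewrite -real_pointD !subrK.
Qed.

HB.instance Definition _ :=
  GRing.isZmodMorphism.Build M realification real_point real_point_zmod_morphism.

(* The R-linear extension of l: P (x) c |-> c * l P (extendE, extend_point, extend_linear). *)
Definition extend (l : {additive M -> int}) (v : realification) : R :=
  fglift (fun P : M => (l P)%:~R : R^o) (repr (v : Quotient.quot add_relations)).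

Section ExtendTheory.
Variable l : {additive M -> int}.
Let f := fun P : M => ((l P)%:~R : R^o).

Let liftD u v : fglift f (u + v) = fglift f u + fglift f v.
Proof.
have add := @lift_is_additive _ M R^o f; have h := add u (- v).
by rewrite opprK in h; rewrite h -[- v]sub0r !add -[in fglift f 0](subrr 0) add subrr sub0r opprK.
Qed.

Let liftZ k u : fglift f (k *: u) = k * fglift f u.
Proof.
rewrite -[u]freeg_sumE scaler_sumr.
have lift_sum (I : Type) (s : seq I) (F : I -> {freeg M / R}) :
  fglift f (\sum_(i <- s) F i) = \sum_(i <- s) fglift f (F i).
  elim: s => [|i s IH]; last by rewrite !big_cons liftD IH.
  by rewrite !big_nil -(subrr 0) (@lift_is_additive _ M R^o f) subrr.
rewrite !lift_sum mulr_sumr; apply: eq_bigr => P _.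
rewrite liftU; have -> : k *: << coeff P u *g P >> = << k * coeff P u *g P >>.
  by apply/eqP/freeg_eqP=> Q; rewrite coeffZ !coeffU mulrA.
by rewrite liftU /GRing.scale /= mulrA.
Qed.

Let lift_rel u : u \in add_relations -> fglift f u = 0.
Proof.
move=> /asboolP[s ->]; elim: s => [|x s IH].
  by rewrite big_nil -(subrr 0) (@lift_is_additive _ M R^o f) subrr.
rewrite big_cons liftD IH addr0 liftZ /add_relation.
rewrite !(@lift_is_additive _ M R^o f) !liftU !scale1r /f raddfD intrD.
by rewrite addrAC addrK subrr mulr0.
Qed.

Lemma extendE u : extend l (to_realification u) = fglift f u.
Proof.
apply/eqP; rewrite -subr_eq0; apply/eqP.
rewrite -(@lift_is_additive _ M R^o f); apply: lift_rel.
by rewrite -to_realification_eq to_realificationP.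
Qed.

Lemma extend_point P : extend l (real_point P) = (l P)%:~R.
Proof. by rewrite extendE liftU scale1r. Qed.

Lemma extend_linear : linear (extend l : realification -> R^o).
Proof.
move=> k u v; rewrite -(to_realificationP u) -(to_realificationP v).
rewrite [k *: _]realification_scaleE -to_realificationD !extendE liftD liftZ.
by [].
Qed.

Lemma extendD u v : extend l (u + v) = extend l u + extend l v.
Proof. by have := extend_linear 1 u v; rewrite !scale1r. Qed.

Lemma extendZ k v : extend l (k *: v) = k * extend l v.
Proof. by rewrite -(to_realificationP v) [k *: _]realification_scaleE !extendE liftZ. Qed.

HB.instance Definition _ :=
  GRing.isLinear.Build R realification R^o *:%R (extend l) extend_linear.
End ExtendTheory.

Definition integral_points : {pred realification} :=
  fun v => `[< exists P : M, v = real_point P >].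

Lemma integral_points_zmod_closed : zmod_closed integral_points.
Proof.
split; first by apply/asboolP; exists 0; rewrite raddf0.
move=> u v /asboolP[P ->] /asboolP[Q ->]; apply/asboolP.
by exists (P - Q); rewrite raddfB.
Qed.

HB.instance Definition _ :=
  GRing.isZmodClosed.Build realification integral_points integral_points_zmod_closed.

End ExtensionOfScalars.

(* V_E = M_E (x) R and T_E = V_E / M_E. Neither the height pairing on V_E nor a
   topology on T_E enters the winding numbers below, so none is attached. *)
Definition mw_space (R : realType) (E : elliptic_curve) : lmodType R :=
  realification R (mw_lattice E).

Definition height_torus (R : realType) (E : elliptic_curve) : zmodType :=
  Quotient.quot (@integral_points R (mw_lattice E)).

Definition to_torus (R : realType) (E : elliptic_curve) (v : mw_space R E) :
    height_torus R E :=
  \pi_(height_torus R E) v.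

Definition character (E : elliptic_curve) : Type := {additive mw_lattice E -> int}.

Definition window_lift (R : realType) (E : elliptic_curve) (l : character E * character E)
    (v : mw_space R E) : 'rV[R]_4 :=
  \row_(k < 4) [:: cos (2%:R * pi * extend l.1 v); sin (2%:R * pi * extend l.1 v);
                   cos (2%:R * pi * extend l.2 v); sin (2%:R * pi * extend l.2 v)]`_k.

(* Independent of the representative: window_to_torus. *)
Definition window (R : realType) (E : elliptic_curve) (l : character E * character E)
    (x : height_torus R E) : 'rV[R]_4 :=
  window_lift l (repr x).

Lemma window_to_torus (R : realType) (E : elliptic_curve)
    (l : character E * character E) (v : mw_space R E) :
  window l (to_torus v) = window_lift l v.
Proof.
set u : mw_space R E := repr (to_torus v).
have : u - v \in @integral_points R (mw_lattice E).
  by rewrite Quotient.idealrBE /u reprK.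
move=> /asboolP[P uP]; have -> : window l (to_torus v) = window_lift l u by [].
have eu (c : character E) : extend c u = extend c v + (c P)%:~R.
  have -> : u = v + real_point R P by rewrite -uP addrC subrK.
  by rewrite extendD extend_point.
have shift (f : R -> R) : (forall x, f (x + pi *+ 2) = f x) ->
    forall (x : R) (n : int), f (2%:R * pi * (x + n%:~R)) = f (2%:R * pi * x).
  move=> per x n; have per' (k : nat) y : f (y + (pi *+ 2) *+ k) = f y.
    by elim: k => [|k IH]; rewrite ?mulr0n ?addr0 // mulrSr addrA per.
  have -> : 2%:R * pi * (x + n%:~R) = 2%:R * pi * x + (pi *+ 2) *~ n.
    by rewrite mulrDr mulrzr mulr_natl.
  case: n => k; first exact: per'.
  by rewrite NegzE mulrNz -[LHS](per' k.+1) pmulrn subrK.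
by apply/rowP=> k; rewrite !mxE !eu !(shift cos) ?(shift sin) //; do ?[exact: cosD2pi | exact: sinD2pi].
Qed.

Definition window_circle (R : realType) (j : 'I_2) (w : 'rV[R]_4) : R * R :=
  if j == 0 then (w 0 0, w 0 1) else (w 0 2%:R, w 0 3%:R).

Definition joint_window (R : realType) (E : elliptic_curve) (m : nat)
    (l : 'I_m -> character E * character E) (x : height_torus R E) : 'M[R]_(m, 4) :=
  \matrix_(i < m) window (l i) x.

(* The class of P in H_1(T_E, Z) is represented by the loop t |-> tP + M_E, and
   classes in H_1 of a product of circles are read off by the winding numbers of
   the coordinate loops: joint_homology is the map
     M_E = H_1(T_E, Z) -> H_1((S^1)^(2m), Z) = Z^(2m)
   induced by the joint window, with Z^(2m) laid out as m rows of 2. *)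
Definition point_loop (R : realType) (E : elliptic_curve) (P : mw_lattice E) (t : R) :
    height_torus R E :=
  to_torus (t *: real_point R P : mw_space R E).

Definition is_winding_number (R : realType) (g : R -> R * R) (k : int) : Prop :=
  exists theta : R -> R,
    [/\ {within `[0, 1], continuous theta},
        forall t, t \in `[0, 1] ->
          g t = (cos (2%:R * pi * theta t), sin (2%:R * pi * theta t))
      & theta 1 - theta 0 = k%:~R].

Definition winding_number (R : realType) (g : R -> R * R) : int :=
  xget 0 [set k | is_winding_number g k].

Definition joint_homology (R : realType) (E : elliptic_curve) (m : nat)
    (l : 'I_m -> character E * character E) (P : mw_lattice E) : 'M[int]_(m, 2) :=
  \matrix_(i < m, j < 2)
    winding_number (fun t : R => window_circle j (row i (joint_window l (point_loop P t)))).

Definition joint_homology_injective (R : realType) (E : elliptic_curve) (m : nat) : Prop :=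
  exists l : 'I_m -> character E * character E, injective (joint_homology R l).

(* Main.v *)
Require Import Defs.
From HB Require Import structures.
From mathcomp Require Import all_boot all_order all_algebra.
From mathcomp Require Import all_classical all_reals all_analysis.
From mathcomp Require Import zify ring lra.

(** A character window is constant-speed on the loops that represent homology
classes: along [t |-> tP + M] its two circle coordinates have angles
[2 pi t l1(P)] and [2 pi t l2(P)].  A winding number does not depend on the
chosen angle function, because two continuous lifts of one loop differ by a
continuous integer-valued function, which is constant on [[0, 1]]
([winding_number_unique]).  Hence the map on first homology is just evaluation
of the characters, [P |-> (l1(P), l2(P))], one row per window
([joint_homologyE]), and geometry leaves the problem.

What remains is a fact about a free abelian group [M] of rank [r]: the least
size of a family of characters with trivial common kernel is [r].  The [r]
coordinate characters of a basis suffice ([Zbasis_coordinates]), and fewer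
than [r] characters always kill a common nonzero vector, since an integer matrix
with more rows than columns has a nonzero integer row relation
([int_row_relation], [joint_kernel_card]).  As [m] windows are the same as
[2m] characters, unused slots being filled by the zero character, injectivity
is possible exactly when [r <= 2m], that is [ceil(r / 2) <= m]. *)

Set Implicit Arguments.
Unset Strict Implicit.
Unset Printing Implicit Defensive.

Import Order.TTheory GRing.Theory Num.Theory.
Import numFieldNormedType.Exports.

Local Open Scope ring_scope.

(** * Winding numbers *)

(** The half-angle formula turns [cos (2 pi d) = 1] into [sin (pi d) = 0], and
[sin] has no zero strictly between [0] and [pi]; so the fractional part of
[d] vanishes. *)
Lemma cos_2pi_eq1_int (R : realType) (d : R) :
  cos (2%:R * pi * d) = 1 -> d \is a Num.int.
Proof.
move=> cd1; have sd0 : sin (pi * d) = 0.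
  have : cos ((pi * d) *+ 2) = 1 by rewrite -mulr_natl mulrA.
  rewrite cos_mulr2n => h; apply/eqP; rewrite -sqrf_eq0 sin2cos2.
  rewrite subr_eq0 eq_sym; apply/eqP.
  by move: h; rewrite -mulr_natl; lra.
have fsd0 (n : int) : sin (pi * (d - n%:~R)) = 0.
  rewrite mulrBr sinB sd0 mul0r sub0r.
  have : sin (pi * n%:~R : R) = 0.
    have nat_case k : sin (pi * k%:R : R) = 0.
      elim: k => [|k IH]; first by rewrite mulr0 sin0.
      by rewrite -[k.+1]addn1 natrD mulrDr mulr1 sinDpi IH oppr0.
    by case: n => k; rewrite ?NegzE ?mulrNz ?mulrN ?sinN -?pmulrn nat_case ?oppr0.
  by move=> ->; rewrite mulr0 oppr0.
rewrite intrEfloor; have /andP[fl fu] := floor_itv d.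
set n := Num.floor d in fl fu *; rewrite eq_sym -subr_eq0.
have d0 : 0 <= d - n%:~R by rewrite subr_ge0.
move: d0; rewrite le_eqVlt eq_sym => /predU1P[-> //|d0].
have d1 : d - n%:~R < 1 by rewrite ltrBlDl -intrD1.
have : 0 < sin (pi * (d - n%:~R)).
  by apply: sin_gt0_pi; rewrite mulr_gt0 ?pi_gt0 //= gtr_pMr ?pi_gt0.
by rewrite fsd0 ltxx.
Qed.

(** By the intermediate value theorem a non-constant [d] would take a value half
a unit away from the integer [d 0]. *)
Lemma continuous_int_const (R : realType) (d : R -> R) :
  {within `[0, 1], continuous d}%classic ->
  (forall t, t \in `[0, 1] -> d t \is a Num.int) -> d 1 = d 0.
Proof.
move=> dc dint.
have hit v : Num.min (d 0) (d 1) <= v <= Num.max (d 0) (d 1) -> v \is a Num.int.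
  by move=> /(IVT ler01 dc)[t t01 <-]; apply: dint.
have not_half (n : int) : (n%:~R + 2%:R^-1 : R) \isn't a Num.int.
  apply/negP=> /intrP[k hk].
  have h2 : ((2%:R * n + 1)%:~R : R) = (2%:R * k)%:~R.
    by rewrite intrD !intrM -hk; field.
  have /eqP := h2; rewrite eqr_int => /eqP; lia.
have /intrP[a ea] : d 0 \is a Num.int by apply: dint; rewrite in_itv /= lexx ler01.
have /intrP[b eb] : d 1 \is a Num.int by apply: dint; rewrite in_itv /= lexx ler01.
rewrite ea eb in hit *.
case: (ltgtP a b) => [ab|ba|-> //].
  have h : (a%:~R + 1 <= b%:~R :> R) by rewrite -intrD1 ler_int lezD1.
  case/negP: (not_half a); apply: hit.
  by rewrite ge_min le_max; apply/andP; split; apply/orP; [left|right]; lra.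
have h : (b%:~R + 1 <= a%:~R :> R) by rewrite -intrD1 ler_int lezD1.
case/negP: (not_half b); apply: hit.
by rewrite ge_min le_max; apply/andP; split; apply/orP; [right|left]; lra.
Qed.

(** Two angle functions [s] and [u] of one loop satisfy
[cos (2 pi (s t - u t)) = 1] for all [t], so they differ by an integer constant
and have the same total increment. *)
Lemma winding_number_unique (R : realType) (g : R -> R * R) (k : int) :
  is_winding_number g k -> winding_number g = k.
Proof.
move=> gk; apply: xget_unique => // k' [s [sc sg sk]].
case: gk => u [uc ug uk].
have dc : {within `[0, 1], continuous (fun t => s t - u t)}%classic.
  by move=> t; apply: cvgB; [exact: sc | exact: uc].
have : s 1 - u 1 = s 0 - u 0.
  apply: (continuous_int_const dc) => t t01; apply: cos_2pi_eq1_int.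
  have := sg t (mem_set t01); rewrite (ug t (mem_set t01)) => -[ec es].
  by rewrite mulrBr cosB -ec -es -!expr2 cos2Dsin2.
move=> h; apply/eqP; rewrite -(eqr_int R) -sk -uk; apply/eqP; lra.
Qed.

Lemma winding_number_linear (R : realType) (k : int) :
  winding_number (fun t : R =>
    (cos (2%:R * pi * (t * k%:~R)), sin (2%:R * pi * (t * k%:~R)))) = k.
Proof.
apply: winding_number_unique; exists (fun t => t * k%:~R); split => //.
  by apply: continuous_subspaceT => t; exact: mulrr_continuous.
by rewrite mul1r mul0r subr0.
Qed.

(** * The homology of the joint window *)

Definition circle_character (E : elliptic_curve)
    (l : character E * character E) (j : 'I_2) : character E :=
  if j == 0 then l.1 else l.2.

(** Along the loop of [P] the linear extension of a character [c] takes the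
value [t * c P], so each circle is traversed at constant speed. *)
Lemma joint_homologyE (R : realType) (E : elliptic_curve) (m : nat)
    (l : 'I_m -> character E * character E) (P : mw_lattice E) i j :
  joint_homology R l P i j = circle_character (l i) j P.
Proof.
rewrite mxE -[RHS](winding_number_linear R); congr winding_number.
apply/funext => t.
have -> : row i (joint_window l (point_loop P t))
          = window_lift (l i) (t *: real_point R P : mw_space R E).
  by rewrite rowK window_to_torus.
rewrite /window_circle /circle_character.
by case: ifP => _; rewrite !mxE /= extendZ extend_point.
Qed.

Lemma joint_homology_injP (R : realType) (E : elliptic_curve) (m : nat)
    (l : 'I_m -> character E * character E) :
  injective (joint_homology R l) <->
  (forall P, (forall i j, circle_character (l i) j P = 0) -> P = 0).
Proof.
split=> [inj P P0|ker P Q PQ].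
  by apply: inj; apply/matrixP=> i j; rewrite !joint_homologyE P0 raddf0.
apply/eqP; rewrite -subr_eq0; apply/eqP/ker => i j.
by rewrite raddfB -!(joint_homologyE R l) PQ subrr.
Qed.

(** * Characters of a free abelian group *)

(** In Smith normal form [A = L D U] the row of [D] beyond the last column
is zero, so the corresponding row of [L^-1] is killed by [A]. *)
Lemma int_row_relation (m n : nat) (A : 'M[int]_(m, n)) :
  (n < m)%N -> exists2 v : 'rV[int]_m, v != 0 & v *m A = 0.
Proof.
move=> nm; have [L Lu [U Uu [d _ ->]]] := int_Smith_normal_form A.
pose i0 := Ordinal nm; exists (delta_mx 0 i0 *m invmx L).
  apply: contraTneq isT => /(congr1 (mulmx^~ L)).
  rewrite /= mulmxKV // mul0mx => /matrixP/(_ 0 i0).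
  by rewrite !mxE !eqxx.
rewrite !mulmxA mulmxKV // -rowE.
suff -> : row i0 (\matrix_(i < m, j < n) (d`_i *+ (i == j :> nat))) = 0.
  by rewrite mul0mx.
by apply/rowP=> j; rewrite !mxE /= gtn_eqF.
Qed.

Lemma Zbasis_coordinates (M : zmodType) (r : nat) (e : 'I_r -> M) :
  is_Zbasis e -> exists c : 'I_r -> {additive M -> int},
    forall P, P = \sum_(i < r) e i *~ c i P.
Proof.
move=> eB; have /choice[c cP] : forall P, exists k : 'rV[int]_r,
    P = \sum_(i < r) e i *~ k 0 i /\
    forall k' : 'rV[int]_r, P = \sum_(i < r) e i *~ k' 0 i -> k = k'.
  by move=> P; have [k [? ?]] := eB P; exists k.
have cB i : zmod_morphism (fun P => c P 0 i).
  move=> P Q; have -> : c (P - Q) = c P - c Q; last by rewrite !mxE.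
  apply: (cP (P - Q)).2; rewrite {1}(cP P).1 {1}(cP Q).1 -sumrB.
  by apply: eq_bigr => j _; rewrite !mxE mulrzBr.
pose ca i : {additive M -> int} :=
  HB.pack (fun P => c P 0 i)
    (GRing.isZmodMorphism.Build M int (fun P => c P 0 i) (cB i)).
by exists ca => P; exact: (cP P).1.
Qed.

(** An integer relation between the rows of values [phi_j(e_i)], [i] ranging over
the basis, gives the coordinates of an element killed by every [phi_j]. *)
Lemma joint_kernel_card (M : zmodType) (r : nat) (e : 'I_r -> M) (J : finType)
    (phi : J -> {additive M -> int}) :
  is_Zbasis e -> (forall P, (forall j, phi j P = 0) -> P = 0) -> (r <= #|J|)%N.
Proof.
move=> eB ker; rewrite leqNgt; apply/negP=> Jr.
have [v v0 vA] := int_row_relation (\matrix_(i < r, k < #|J|) phi (enum_val k) (e i)) Jr.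
have Pv0 : \sum_(i < r) e i *~ v 0 i = 0.
  apply: ker => j; rewrite raddf_sum.
  have /rowP/(_ (enum_rank j)) := vA; rewrite !mxE => sum0.
  rewrite -[RHS]sum0; apply: eq_bigr => i _.
  by rewrite mxE enum_rankK raddfMz mulrzz mulrC.
have [k [_ k0]] := eB 0.
case/eqP: v0; rewrite -(k0 v) //; apply: k0.
by rewrite big1 // => i _; rewrite mxE.
Qed.

(* uphalf r is the ceiling of r / 2 *)
Theorem theorem7p3 (R : realType) (E : elliptic_curve) (r : nat)
    (hr : mordell_weil_rank E r) :
  joint_homology_injective R E (uphalf r) /\
  forall m : nat, joint_homology_injective R E m -> (uphalf r <= m)%N.
Proof.
case: hr => e eB; split=> [|m [l /joint_homology_injP ker]]; last first.
  rewrite leq_uphalf_double -muln2 -[m in leqRHS]card_ord -[2%N]card_ord -card_prod.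
  apply: (joint_kernel_card
            (phi := fun ij : 'I_m * 'I_2 => circle_character (l ij.1) ij.2) eB).
  by move=> P P0; apply: ker => i j; exact: (P0 (i, j)).
have [c cP] := Zbasis_coordinates eB.
(* padding: for odd r the last window has one coordinate to spare *)
pose c' n : character E := if insub n is Some i then c i else \0.
exists (fun i => (c' i.*2, c' i.*2.+1)); apply/joint_homology_injP => P P0.
rewrite [P]cP big1 // => k _; suff -> : c k P = 0 by [].
have hk : (k./2 < uphalf r)%N by rewrite gtn_uphalf_double; have := ltn_ord k; lia.
have ck : c' k = c k by rewrite /c' valK.
rewrite -ck -(odd_double_half k); case: (odd k).
  exact: (P0 (Ordinal hk) 1).
exact: (P0 (Ordinal hk) 0).
Qed.
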